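(* Let $\widehat{\mathbf{A}}\in\mathbb{C}^{N\times N}$ be an arbitrary matrix and let $\widehat{\mathbf{b}}\in\mathrm{im}(\widehat{\mathbf{A}})$ (i.e., the linear system $\widehat{\mathbf{A}}\widehat{\mathbf{x}}=\widehat{\mathbf{b}}$ is consistent). Then the following two conditions are equivalent: 1. For every initial guess $\mathbf{x}_0\in\mathbb{C}^N$ the GMRES method applied to the system $\widehat{\mathbf{A}}\widehat{\mathbf{x}}=\widehat{\mathbf{b}}$ is well defined at each iteration step $n$ and it terminates with a solution of the system. 2. $\ker(\widehat{\mathbf{A}})\cap\mathrm{im}(\widehat{\mathbf{A}})=\{\mathbf{0}\}$.
   Context: For $\mathbf{C}\in\mathbb{C}^{N\times N}$ and $\mathbf{v}\in\mathbb{C}^N$, $\mathcal{K}_n(\mathbf{C},\mathbf{v}):=\mathrm{span}\{\mathbf{v},\mathbf{C}\mathbf{v},\dots,\mathbf{C}^{n-1}\mathbf{v}\}$, with $\mathcal{K}_0=\{\mathbf{0}\}$; $\perp$ is Euclidean orthogonality in $\mathbb{C}^N$. GMRES (in exact arithmetic) applied to $\widehat{\mathbf{A}}\widehat{\mathbf{x}}=\widehat{\mathbf{b}}$ with initial guess $\mathbf{x}_0$ and initial residual $\mathbf{r}_0=\widehat{\mathbf{b}}-\widehat{\mathbf{A}}\mathbf{x}_0$ is mathematically characterized as follows. Its $n$-th iterate $\mathbf{x}_n$ is determined by the conditions $$\mathbf{x}_n\in\mathbf{x}_0+\mathcal{K}_n(\widehat{\mathbf{A}},\mathbf{r}_0),\qquad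 \widehat{\mathbf{b}}-\widehat{\mathbf{A}}\mathbf{x}_n\perp\widehat{\mathbf{A}}\mathcal{K}_n(\widehat{\mathbf{A}},\mathbf{r}_0),$$ equivalently, $\mathbf{x}_n$ minimizes $\|\widehat{\mathbf{b}}-\widehat{\mathbf{A}}\mathbf{y}\|_2$ over $\mathbf{y}\in\mathbf{x}_0+\mathcal{K}_n(\widehat{\mathbf{A}},\mathbf{r}_0)$. Let $d\ge 0$ be the smallest integer with $\mathcal{K}_{d+1}(\widehat{\mathbf{A}},\mathbf{r}_0)=\mathcal{K}_d(\widehat{\mathbf{A}},\mathbf{r}_0)$ (so $d=0$ iff $\mathbf{r}_0=\mathbf{0}$). The iteration runs over $n=1,\dots,d$ and terminates at step $d$. It is well defined at step $n$ if there is exactly one vector $\mathbf{x}_n$ satisfying both $\mathbf{x}_n\in\mathbf{x}_0+\mathcal{K}_n(\widehat{\mathbf{A}},\mathbf{r}_0)$ and $\widehat{\mathbf{b}}-\widehat{\mathbf{A}}\mathbf{x}_n\perp\widehat{\mathbf{A}}\mathcal{K}_n(\widehat{\mathbf{A}},\mathbf{r}_0)$. It terminates with a solution if $\mathbf{x}_d$ is (well defined and) a solution of $\widehat{\mathbf{A}}\widehat{\mathbf{x}}=\widehat{\mathbf{b}}$. *)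

(* Defs.v *)
From HB Require Import structures.
From mathcomp Require Import all_boot all_order all_algebra.
From mathcomp Require Import reals complex.

Set Implicit Arguments.
Unset Strict Implicit.
Unset Printing Implicit Defensive.

Import GRing.Theory.
Local Open Scope ring_scope.

Section Gmres.
Variables (C : numClosedFieldType) (N : nat).
Implicit Types (A : 'M[C]_N) (b r v x : 'cV[C]_N) (U : {vspace 'cV[C]_N}).

(* The endomorphism x |-> A x of column vectors; MathComp's kermx and row
   spaces refer instead to the action v |-> v A on row vectors. *)
Definition mxend A : 'End('cV[C]_N) := linfun (mulmx A).

Definition krylov A v (n : nat) : {vspace 'cV[C]_N} :=
  <<mkseq (fun k => (A ^+ k) *m v) n>>%VS.

(* dotmx is the Hermitian product \sum_i u_i (v_i)^* on row vectors. *)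
Definition orth_to_space r U : Prop :=
  forall w, w \in U -> dotmx r^T w^T = 0.

Lemma krylovS_sub A v n : (krylov A v n <= krylov A v n.+1)%VS.
Proof.
apply: sub_span => w /mapP[k]; rewrite mem_iota => /andP[_ kn] ->.
by apply/mapP; exists k; rewrite // mem_iota /= (leq_trans kn).
Qed.

Lemma krylov_stabilizes A v : exists d, krylov A v d.+1 == krylov A v d.
Proof.
have [/existsP[d dP]|/existsPn noP] :=
  boolP [exists d : 'I_N.+1, krylov A v d.+1 == krylov A v d].
  by exists d.
have dimK n : (n <= N.+1)%N -> (n <= \dim (krylov A v n))%N.
  elim: n => // n IHn ltnN; apply: leq_ltn_trans (IHn (ltnW ltnN)) _.
  rewrite ltnNge; apply/negP => dim_le.
  have := noP (Ordinal ltnN); rewrite /= eq_sym => /negP; apply.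
  by rewrite eqEdim krylovS_sub.
have := leq_trans (dimK _ (leqnn _)) (dimvS (subvf _)).
by rewrite dimvf /dim /= muln1 ltnn.
Qed.

(* The smallest d >= 0 with K_{d+1}(A, v) = K_d(A, v). *)
Definition krylov_grade A v : nat := ex_minn (krylov_stabilizes A v).

Definition residual A b x : 'cV[C]_N := b - A *m x.

Definition gmres_iterate A b x0 (n : nat) x : Prop :=
  x - x0 \in krylov A (residual A b x0) n /\
  orth_to_space (residual A b x) (mxend A @: krylov A (residual A b x0) n)%VS.

Definition gmres_well_defined_at A b x0 (n : nat) : Prop :=
  exists! x, gmres_iterate A b x0 n x.

Definition gmres_last_step A b x0 : nat := krylov_grade A (residual A b x0).

Definition gmres_well_defined A b x0 : Prop :=
  forall n, (1 <= n <= gmres_last_step A b x0)%N ->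
    gmres_well_defined_at A b x0 n.

Definition gmres_terminates_with_solution A b x0 : Prop :=
  exists x, unique (gmres_iterate A b x0 (gmres_last_step A b x0)) x /\
            A *m x = b.

End Gmres.

(* Main.v *)
(** Everything happens inside [im A], which contains the initial residual and
    hence all its Krylov spaces.  If [ker A] meets [im A] trivially, then [A] is
    injective on each Krylov space [K], so orthogonally projecting the residual
    onto [A K] yields exactly one iterate; at the last step [A K] and [K] have
    the same dimension and [A K <= K], so the residual lies in [A K] and is
    annihilated.  Conversely, for [y] in both [ker A] and [im A], some initial
    guess has residual [y]; the whole Krylov space of [y] lies in [ker A], so
    the residual never changes and GMRES can only reach a solution if [y = 0]. *)
Require Import Defs.
From mathcomp Require Import all_boot all_order all_algebra.
From mathcomp Require Import reals complex.

Import GRing.Theory.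
Local Open Scope ring_scope.

Section Gmres.
Context {C : numClosedFieldType} {N : nat}.
Implicit Types (A : 'M[C]_N) (b r v x y : 'cV[C]_N) (U W : {vspace 'cV[C]_N}).

Lemma mxendE A x : mxend A x = A *m x.
Proof. by rewrite lfunE. Qed.

(** [proj_ortho] acts on row vectors, so a basis of [W] is transposed into the rows of a matrix [U];
    [w] is the projection of [r^T] onto its row space, transposed back. *)
Lemma orth_decomp W r : exists2 w, w \in W & orth_to_space (r - w) W.
Proof.
pose U := \matrix_(i < \dim W) ((vbasis W)`_i)^T.
have UE (u : 'rV_(\dim W)) :
    (u *m U)^T = \sum_(i < \dim W) u 0 i *: (vbasis W)`_i.
  rewrite mulmx_sum_row linear_sum; apply: eq_bigr => i _.
  by rewrite linearZ /= rowK trmxK.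
have [u uE] := submxP (proj_ortho_sub U r^T).
exists (r^T *m proj_ortho U)^T.
  rewrite uE UE; apply: memv_suml => i _; apply/memvZ/vbasis_mem.
  by rewrite mem_nth // size_tuple.
move=> w wW; have wU : (w^T <= U)%MS.
  apply/submxP; exists (\row_i coord (vbasis W) i w).
  apply: trmx_inj; rewrite trmxK UE {1}(coord_vbasis wW).
  by apply: eq_bigr => i _; rewrite mxE.
have /orthomxP/(_ _ _ (submx_refl _) wU)/orthomx1P := proj_ortho_compl_sub U r^T.
by move=> wO; rewrite linearB /= trmxK dotmxE wO mxE.
Qed.

Lemma orth_to_spaceB W r r' :
  orth_to_space r W -> orth_to_space r' W -> orth_to_space (r - r') W.
Proof.
move=> rW r'W w wW.
by rewrite linearB linearBl /= rW // r'W // subrr.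
Qed.

Lemma orth_mem_eq0 W r : r \in W -> orth_to_space r W -> r = 0.
Proof.
move=> rW /(_ r rW)/eqP; rewrite dnorm_eq0 => /eqP r0.
by apply: trmx_inj; rewrite r0 trmx0.
Qed.

(** Serves for two [A]-stable subspaces: the image and the kernel of [A]. *)
Lemma krylov_sub A v n U :
  v \in U -> (forall u, u \in U -> A *m u \in U) -> (krylov A v n <= U)%VS.
Proof.
move=> vU AU; apply/span_subvP => _ /mapP[k _ ->].
elim: k => [|k IHk]; first by rewrite expr0 mul1mx.
by rewrite exprS -mulmxA AU.
Qed.

Lemma mem_krylovS A v n : v \in krylov A v n.+1.
Proof. by apply/memv_span/mapP; exists 0%N; rewrite ?expr0 ?mul1mx. Qed.

Lemma limg_krylov_sub A v n : (mxend A @: krylov A v n <= krylov A v n.+1)%VS.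
Proof.
rewrite limg_span; apply/span_subvP => _ /mapP[_ /mapP[k kn ->] ->].
apply/memv_span/mapP; exists k.+1; last by rewrite mxendE mulmxA exprS.
by move: kn; rewrite !mem_iota.
Qed.

Lemma krylov_gradeE A v :
  krylov A v (krylov_grade A v).+1 = krylov A v (krylov_grade A v).
Proof. by rewrite /krylov_grade; case: ex_minnP => d /eqP. Qed.

Lemma residualD A b x z : residual A b (x + z) = residual A b x - A *m z.
Proof. by rewrite /residual mulmxDr opprD addrA. Qed.

Lemma krylov_limg_sub A v n :
  v \in limg (mxend A) -> (krylov A v n <= limg (mxend A))%VS.
Proof.
move=> vA; apply: krylov_sub vA _ => u _.
by rewrite -mxendE memv_img ?memvf.
Qed.

Section Sufficiency.
Variables (A : 'M[C]_N) (b x0 : 'cV[C]_N).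
Hypothesis bA : b \in limg (mxend A).
Hypothesis kerA : (lker (mxend A) :&: limg (mxend A))%VS = 0%VS.

Let r0 := residual A b x0.

Lemma residual_limg : r0 \in limg (mxend A).
Proof. by rewrite rpredB // -mxendE memv_img ?memvf. Qed.

Lemma krylov_cap_ker n : (krylov A r0 n :&: lker (mxend A) = 0)%VS.
Proof.
apply/eqP; rewrite -subv0 -kerA capvC.
exact: capvS (subvv _) (krylov_limg_sub _ _ _ residual_limg).
Qed.

Lemma gmres_iterate_uniq n x y :
  gmres_iterate A b x0 n x -> gmres_iterate A b x0 n y -> x = y.
Proof.
move=> [xK xO] [yK yO].
have zK : x - y \in krylov A r0 n.
  by have := rpredB xK yK; rewrite opprB addrA subrK.
have zE : residual A b y - residual A b x = mxend A (x - y).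
  by rewrite mxendE mulmxBr /residual addrC opprB addrA subrK.
(* As a difference of two residuals, this vector is orthogonal to [A K], in which it also lies. *)
have z0 : mxend A (x - y) = 0.
  apply: orth_mem_eq0 (memv_img _ zK) _.
  by rewrite -zE; apply: orth_to_spaceB.
have : x - y \in (krylov A r0 n :&: lker (mxend A))%VS.
  by rewrite memv_cap zK memv_ker z0 eqxx.
by rewrite krylov_cap_ker memv0 subr_eq0 => /eqP.
Qed.

Lemma gmres_iterate_exists n : exists x, gmres_iterate A b x0 n x.
Proof.
(* The projection of [r0] onto [A K] is some [A z] with [z] in [K]; the iterate is [x0 + z]. *)
have [_ /memv_imgP[z zK ->] zO] := orth_decomp (mxend A @: krylov A r0 n)%VS r0.
by exists (x0 + z); split; rewrite ?residualD -?mxendE // addrC addKr.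
Qed.

Lemma gmres_well_definedT n : gmres_well_defined_at A b x0 n.
Proof.
have [x xP] := gmres_iterate_exists n.
by exists x; split=> // y; apply: gmres_iterate_uniq.
Qed.

Lemma gmres_last_step_solves : gmres_terminates_with_solution A b x0.
Proof.
set d := gmres_last_step A b x0.
have AK : (mxend A @: krylov A r0 d)%VS = krylov A r0 d.
  apply/eqP; rewrite eqEdim limg_dim_eq ?krylov_cap_ker // leqnn andbT.
  by rewrite -{2}krylov_gradeE limg_krylov_sub.
(* Passing through [d.+1] also covers [d = 0], where the Krylov space is zero and [r0 = 0]. *)
have : r0 \in krylov A r0 d by rewrite -krylov_gradeE mem_krylovS.
rewrite -{1}AK => /memv_imgP[z zK r0E].
have res0 : residual A b (x0 + z) = 0.
  by rewrite residualD -/r0 r0E mxendE subrr.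
exists (x0 + z); split; last by apply/esym/subr0_eq.
have zP : gmres_iterate A b x0 d (x0 + z).
  split; first by rewrite addrC addKr.
  by move=> w _; rewrite res0 dotmxE trmx0 mul0mx mxE.
by split=> // y; apply: gmres_iterate_uniq.
Qed.

End Sufficiency.

Lemma gmres_solution_ker_residual A b x0 :
    A *m residual A b x0 = 0 ->
  gmres_terminates_with_solution A b x0 -> residual A b x0 = 0.
Proof.
move=> Ar0 [x [[[xK _] _] Axb]].
have KA : (krylov A (residual A b x0) (gmres_last_step A b x0)
             <= lker (mxend A))%VS.
  apply: krylov_sub => [|u]; first by rewrite memv_ker mxendE Ar0.
  by rewrite !memv_ker !mxendE => /eqP->; rewrite mulmx0.
(* Since [A x = b], the vector [A (x - x0)] is the initial residual itself. *)
move: (subvP KA _ xK); rewrite memv_ker mxendE mulmxBr Axb.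
by move/eqP.
Qed.

End Gmres.

Theorem theorem5p1 (R : realType) (N : nat) (A : 'M[R[i]]_N) (b : 'cV[R[i]]_N)
    (hb : b \in limg (mxend A)) :
  (forall x0 : 'cV[R[i]]_N,
     gmres_well_defined A b x0 /\ gmres_terminates_with_solution A b x0)
  <-> (lker (mxend A) :&: limg (mxend A))%VS = 0%VS.
Proof.
split=> [gmresA | kerA x0]; last first.
  by split=> [n _|]; [apply: gmres_well_definedT | apply: gmres_last_step_solves].
apply/eqP; rewrite -subv0; apply/subvP => y.
rewrite memv_cap memv_ker mxendE memv0 => /andP[/eqP Ay yA].
(* A preimage [x0] of [b - y] under [A] has residual [y]. *)
have /memv_imgP[x0 _ x0E] := rpredB hb yA.
have y_res : residual A b x0 = y by rewrite /residual -mxendE -x0E subKr.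
have [_ sol] := gmresA x0.
by rewrite -y_res; apply/eqP/gmres_solution_ker_residual; rewrite ?y_res.
Qed.
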